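(* Let $A$ be a quadratic division algebra over a field $F$ with $\operatorname{char} F\neq 2$, let $\Delta\in F$, and let $R\colon A\to A$ be a Rota--Baxter operator of weight $\Delta$ on $A$. Then $R$ is trivial, i.e. $R=0$ or $R=-\Delta\,\mathrm{id}$.
   Context: Algebras are not assumed associative or commutative. A linear operator $R\colon A\to A$ on an algebra $A$ over $F$ is a Rota--Baxter operator of weight $\Delta\in F$ if $R(x)R(y)=R(R(x)y+xR(y)+\Delta xy)$ for all $x,y\in A$. An algebra $A$ with unit $1$ is quadratic if every $x\in A$ satisfies $x^2-t(x)x+n(x)1=0$, where the trace $t\colon A\to F$ is linear and the norm $n\colon A\to F$ is a quadratic map; one has $A=F1\oplus A_0$ with $A_0=\{x\in A\mid t(x)=0\}$. A division algebra is a nonzero algebra in which left and right multiplications by every nonzero element are bijective (in particular, it has no zero divisors). *)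

(* Defs.v *)
From mathcomp Require Import all_boot all_order all_algebra.
Set Implicit Arguments.
Unset Strict Implicit.
Unset Printing Implicit Defensive.
Import GRing.Theory.
Local Open Scope ring_scope.

(* The algebras of mathcomp are associative, so a (not necessarily            *)
(* associative, commutative, or finite-dimensional) algebra over F is given   *)
(* here by an F-module A with a bilinear product mul : A -> A -> A.           *)

Definition rota_baxter (F : fieldType) (A : lmodType F)
    (mul : {bilinear A -> A -> A}) (Delta : F) (R : {linear A -> A}) : Prop :=
  forall x y : A,
    mul (R x) (R y) = R (mul (R x) y + mul x (R y) + Delta *: mul x y).

Definition is_unit_element (F : fieldType) (A : lmodType F)
    (mul : {bilinear A -> A -> A}) (e : A) : Prop :=
  forall x : A, mul e x = x /\ mul x e = x.

Definition quadratic_map (F : fieldType) (A : lmodType F) (n : A -> F) : Prop :=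
  (forall (a : F) (x : A), n (a *: x) = a ^+ 2 * n x) /\
  (exists B : {biscalar A}, forall x y : A, n (x + y) - n x - n y = B x y).

(* The condition t e = 2, which gives A = F e (+) ker t in characteristic     *)
(* other than 2, is not imposed: it follows if dim A > 1, and if A = F e then *)
(* t and n can be rechosen so that it holds.                                  *)
Definition quadratic_algebra (F : fieldType) (A : lmodType F)
    (mul : {bilinear A -> A -> A}) (e : A) : Prop :=
  is_unit_element mul e /\
  exists (t : {scalar A}) (n : A -> F),
    quadratic_map n /\ forall x : A, mul x x - t x *: x + n x *: e = 0.

Definition division_algebra (F : fieldType) (A : lmodType F)
    (mul : {bilinear A -> A -> A}) : Prop :=
  (exists x : A, x != 0) /\
  forall a : A, a != 0 ->
    bijective (fun x : A => mul a x) /\ bijective (fun x : A => mul x a).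

(* Main.v *)
(* In a quadratic algebra without zero divisors the unit e is a combination   *)
(* of x and x^2 for every x <> 0, so e lies in the image of R if R <> 0 and,  *)
(* for Delta <> 0, in every nonzero kernel of R or of R + Delta.              *)
(*   If R e = 0, then R x R y with x = e gives (R + Delta) R = 0, so R <> 0   *)
(* would put e in the kernel of R + Delta as well.                            *)
(*   If R e <> 0, write e = R u; then e e = e gives R (u + Delta u^2) = 0,    *)
(* hence u (e + Delta u) = u + Delta u^2 = 0 and R e = - Delta e. This        *)
(* reduces to the first case for the Rota-Baxter operator - (Delta + R).      *)

Require Import Defs.
From mathcomp Require Import all_boot all_order all_algebra.
Set Implicit Arguments.
Unset Strict Implicit.
Unset Printing Implicit Defensive.
Import GRing.Theory.
Local Open Scope ring_scope.

(** A nonzero subspace closed under squaring contains [e]. The image of [R] is closed under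
    squaring, and for [Delta] nonzero so are the kernels of [R] and of its dual [- (Delta + R)]. If
    [R e = 0] while [R] is nonzero, [e] lies where it cannot ([rota_baxter_unit_eq0]); if [R e] is
    nonzero, the dual kills [e] and so vanishes. *)

Lemma division_algebra_mul_eq0 (F : fieldType) (A : lmodType F)
    (mul : {bilinear A -> A -> A}) (x y : A) :
  division_algebra mul -> mul x y = 0 -> x = 0 \/ y = 0.
Proof.
move=> [_ divA] xy0; have [-> | /divA [/bij_inj mulI _]] := eqVneq x 0.
  by left.
by right; apply: mulI; rewrite xy0 linear0r.
Qed.

(** If [n x] is nonzero, solve the quadratic equation for [e]; otherwise [x (x - t x e) = 0] makes
    [x] a nonzero multiple of [e]. *)
Lemma quadratic_division_unit_span (F : fieldType) (A : lmodType F)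
    (mul : {bilinear A -> A -> A}) (e x : A) :
  quadratic_algebra mul e -> division_algebra mul -> x != 0 ->
  exists a b : F, e = a *: x + b *: mul x x.
Proof.
move=> [unit_e [t [n [_ quad]]]] divA x_neq0.
have := quad x; have [-> | nx_neq0] := eqVneq (n x) 0.
  rewrite scale0r addr0 => x2E.
  have : mul x (x - t x *: e) = 0.
    by rewrite linearBr linearZr_LR /= (unit_e x).2.
  case/(division_algebra_mul_eq0 divA) => [x0 | /subr0_eq xE].
    by rewrite x0 eqxx in x_neq0.
  have tx_neq0 : t x != 0.
    by apply: contraNneq x_neq0 => tx0; rewrite xE tx0 scale0r.
  exists (t x)^-1, 0; rewrite scale0r addr0; apply: (scalerI tx_neq0).
  by rewrite scalerA divff // scale1r -xE.
move=> /addr0_eq/esym x2E; exists (t x / n x), (- (n x)^-1).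
apply: (scalerI nx_neq0); rewrite x2E scalerDr !scalerA mulrN divff // scaleN1r.
by rewrite mulrCA divff // mulr1 opprB.
Qed.

(** This duality exchanges the two trivial operators. *)
Lemma rota_baxter_dual (F : fieldType) (A : lmodType F)
    (mul : {bilinear A -> A -> A}) (Delta : F) (R : {linear A -> A}) :
  rota_baxter mul Delta R ->
  rota_baxter mul Delta (\- (Delta \*: idfun \+ R)).
Proof.
move=> RB x y /=; set v := mul (R x) y + mul x (R y) + Delta *: mul x y.
have -> : mul (- (Delta *: x + R x)) y + mul x (- (Delta *: y + R y))
    + Delta *: mul x y = - v.
  rewrite linearNl linearNr linearDl linearDr linearZl_LR linearZr_LR /=.
  rewrite /v -opprD; apply: oppr_inj.
  rewrite [- _ + _]addrC opprB opprK addrAC [_ + _ - _]addrC addKr.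
  by rewrite [_ + mul x (R y)]addrC addrA.
rewrite linearNl linearNr opprK scalerN linearN -opprD opprK -RB.
rewrite !linearDl !linearDr !linearZl_LR !linearZr_LR /= !scalerDr.
rewrite addrA; congr (_ + _).
by rewrite addrC [_ + Delta *: mul x (R y)]addrC addrA.
Qed.

(** The identity at [(w, w)] reduces to [Delta R(w^2) = 0], so the kernel contains [w^2]. *)
Lemma rota_baxter_kernel_unit (F : fieldType) (A : lmodType F)
    (mul : {bilinear A -> A -> A}) (e : A) (Delta : F) (R : {linear A -> A})
    (w : A) :
  quadratic_algebra mul e -> division_algebra mul ->
  rota_baxter mul Delta R -> Delta != 0 -> w != 0 -> R w = 0 -> R e = 0.
Proof.
move=> quadA divA RB Delta_neq0 w_neq0 Rw0.
have Rw2 : R (mul w w) = 0.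
  apply: (scalerI Delta_neq0); rewrite -linearZ scaler0 /=.
  by have := RB w w; rewrite Rw0 !linear0l linear0r !add0r.
have [a [b ->]] := quadratic_division_unit_span quadA divA w_neq0.
by rewrite linearD !linearZ /= Rw0 Rw2 !scaler0 addr0.
Qed.

Lemma rota_baxter_image_unit (F : fieldType) (A : lmodType F)
    (mul : {bilinear A -> A -> A}) (e : A) (Delta : F) (R : {linear A -> A})
    (x : A) :
  quadratic_algebra mul e -> division_algebra mul ->
  rota_baxter mul Delta R -> R x != 0 ->
  exists2 u : A, R u = e & R (u + Delta *: mul u u) = 0.
Proof.
move=> quadA divA RB Rx_neq0; have [unit_e _] := quadA.
have [u Ru] : exists u, e = R u.
  have [a [b eE]] := quadratic_division_unit_span quadA divA Rx_neq0.
  rewrite RB -!linearZ -linearD in eE; eexists; exact: eE.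
exists u => //; apply: (addrI e); rewrite addr0.
have := RB u u; rewrite -Ru (unit_e e).1 (unit_e u).1 (unit_e u).2.
by rewrite -addrA linearD -Ru => <-.
Qed.

Lemma rota_baxter_unit_eq0 (F : fieldType) (A : lmodType F)
    (mul : {bilinear A -> A -> A}) (e : A) (Delta : F) (R : {linear A -> A}) :
  quadratic_algebra mul e -> division_algebra mul ->
  rota_baxter mul Delta R -> R e = 0 -> forall x : A, R x = 0.
Proof.
move=> quadA divA RB Re0 x; have [// | z_neq0] := eqVneq (R x) 0.
have [unit_e _] := quadA.
have e_neq0 : e != 0.
  by apply: contraNneq z_neq0 => e0; rewrite -(unit_e (R x)).1 e0 linear0l.
have [Delta0 | Delta_neq0] := eqVneq Delta 0.
  have [u Ru] := rota_baxter_image_unit quadA divA RB z_neq0.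
  by rewrite Delta0 scale0r addr0 Ru => e0; rewrite e0 eqxx in e_neq0.
(* The identity at [(e, x)] puts [R x] in the kernel of the dual, hence [e] too, so
   [Delta e = 0]. *)
have Rz : Delta *: R x + R (R x) = 0.
  have := RB e x; rewrite Re0 !linear0l add0r !(unit_e _).1.
  by rewrite linearD linearZ addrC => <-.
have := rota_baxter_kernel_unit quadA divA (rota_baxter_dual RB)
  Delta_neq0 z_neq0.
rewrite /= Rz oppr0 Re0 addr0 => /(_ erefl)/eqP.
by rewrite oppr_eq0 scaler_eq0 (negbTE Delta_neq0) (negbTE e_neq0).
Qed.

Theorem theorem1 (F : fieldType) (charF : 2%N \notin [pchar F])
    (A : lmodType F) (mul : {bilinear A -> A -> A}) (e : A)
    (quadA : quadratic_algebra mul e) (divA : division_algebra mul)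
    (Delta : F) (R : {linear A -> A}) (RB : rota_baxter mul Delta R) :
  (forall x : A, R x = 0) \/ (forall x : A, R x = - (Delta *: x)).
Proof.
have [Re0 | Re_neq0] := eqVneq (R e) 0.
  by left; apply: (rota_baxter_unit_eq0 quadA divA RB).
right=> x; apply/eqP; rewrite -addr_eq0 addrC -oppr_eq0; apply/eqP.
apply: (rota_baxter_unit_eq0 quadA divA (rota_baxter_dual RB)) => /=.
have [unit_e _] := quadA.
have [u Ru Rw0] := rota_baxter_image_unit quadA divA RB Re_neq0.
(* If this element of the kernel of [R] vanishes, cancel [u] and apply [R]. If not, [Delta = 0]
   would give [e = R u = 0], and [Delta] nonzero would give [R e = 0]. *)
have [w0 | w_neq0] := eqVneq (u + Delta *: mul u u) 0.
  have : mul u (e + Delta *: u) = 0.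
    by rewrite linearDr linearZr_LR /= (unit_e u).2.
  case/(division_algebra_mul_eq0 divA) => [u0 | ].
    by move: Re_neq0; rewrite -Ru u0 !linear0 eqxx.
  by move/(congr1 R); rewrite linear0 linearD linearZ /= Ru addrC => ->;
    rewrite oppr0.
have [Delta0 | Delta_neq0] := eqVneq Delta 0.
  move: Rw0; rewrite Delta0 !scale0r addr0 add0r Ru => ->.
  by rewrite linear0 oppr0.
have /eqP := rota_baxter_kernel_unit quadA divA RB Delta_neq0 w_neq0 Rw0.
by rewrite (negbTE Re_neq0).
Qed.
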